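(* Let $\mathcal X$, $\mathcal C$, $h$, $D_h$ be as in the context and let $f:\mathcal X\to\mathbb R$ be convex on $\mathcal X$ and differentiable on $\mathcal C$. Let $x_0\in\mathcal C$, $\eta_k>0$, and let $(x_k)_{k\ge0}\subset\mathcal C$ satisfy $$x_{k+1}\in\operatorname*{argmin}_{x\in\mathcal X}\Bigl\{f(x)+\frac1{\eta_k}D_h(x,x_k)\Bigr\},\qquad k\ge0.$$ Assume that $x^\star\in\operatorname{argmin}_{x\in\mathcal X}f(x)$ satisfies $D_h(x^\star,x_0)<\infty$, and write $f^\star=f(x^\star)$ and $S_K:=\sum_{k=0}^K\eta_k$. Then, for every $K\ge0$, $$\sum_{k=0}^K\eta_k\bigl(f(x_{k+1})-f^\star\bigr)\le D_h(x^\star,x_0),$$ and, since the objective values are nonincreasing, $$f(x_{K+1})-f^\star\le\frac{D_h(x^\star,x_0)}{S_K}.$$ Moreover, $k\mapsto D_h(x^\star,x_k)$ is nonincreasing. Consequently, if $S_K\to\infty$, then $f(x_k)\to f^\star$, and every cluster point of $(x_k)$ at which $f$ is continuous is a minimizer of $f$ on $\mathcal X$.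
   Context: $\mathcal X$ is a nonempty closed convex set in a finite-dimensional Euclidean space and $\mathcal C=\operatorname{ri}(\mathcal X)$ is its relative interior. All derivatives are taken along directions of the affine hull $\operatorname{aff}(\mathcal X)$: for $\varphi$ differentiable on $\mathcal C$, $\nabla\varphi(x)$ is the vector in the direction space of $\operatorname{aff}(\mathcal X)$ representing the derivative for the Euclidean inner product. $h:\mathcal C\to\mathbb R$ is a $C^2$ Legendre function (strictly convex, with $\|\nabla h(x_j)\|\to\infty$ whenever $x_j\in\mathcal C$ tends to a point of $\mathcal X\setminus\mathcal C$), extended continuously to those points of $\mathcal X\setminus\mathcal C$ used as comparison points. For $x\in\mathcal X$, $y\in\mathcal C$, $D_h(x,y)=h(x)-h(y)-\langle\nabla h(y),x-y\rangle$; at a boundary point $x$ this is finite when the (finite) continuous extension $h(x)$ exists, and is regarded as $+\infty$ otherwise. *)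

(* Defs.v *)
From HB Require Import structures.
From mathcomp Require Export all_boot all_order all_algebra.
From mathcomp Require Export all_classical all_reals all_analysis.
Export Order.TTheory GRing.Theory Num.Theory numFieldNormedType.Exports.

Set Implicit Arguments.
Unset Strict Implicit.
Unset Printing Implicit Defensive.

Local Open Scope classical_set_scope.
Local Open Scope ring_scope.

(* The Euclidean space is 'rV[R]_n with the inner product [dot]. The library
   norm on 'rV[R]_n is the sup norm: it defines the same topology and the same
   little-o's, and [enorm] is used where the norm itself matters. *)
Definition dot (R : realType) (n : nat) (u v : 'rV[R]_n) : R :=
  \sum_(i < n) u 0 i * v 0 i.

Definition enorm (R : realType) (n : nat) (u : 'rV[R]_n) : R :=
  Num.sqrt (dot u u).

Definition aff (R : realType) (n : nat) (X : set 'rV[R]_n) : set 'rV[R]_n :=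
  [set y | exists (m : nat) (a : 'I_m -> R) (z : 'I_m -> 'rV[R]_n),
     [/\ forall i, X (z i), \sum_(i < m) a i = 1
       & y = \sum_(i < m) a i *: z i]].

Definition aff_dir (R : realType) (n : nat) (X : set 'rV[R]_n) :
    set 'rV[R]_n :=
  [set v | exists y z, [/\ aff X y, aff X z & v = y - z]].

Definition ri (R : realType) (n : nat) (X : set 'rV[R]_n) : set 'rV[R]_n :=
  [set x | X x /\ \forall y \near x, aff X y -> X y].

(* Differentiation along aff X: since ri X is a neighbourhood of each of its
   points in aff X, restricting increments to ri X is the same as restricting
   them to aff X, and only the values of phi on ri X are used. *)
Definition is_rgrad (R : realType) (n : nat) (X : set 'rV[R]_n)
    (phi : 'rV[R]_n -> R) (x g : 'rV[R]_n) : Prop :=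
  aff_dir X g /\
  (fun y => phi y - phi x - dot g (y - x) : R^o)
    =o_ (within (ri X) (nbhs x)) (fun y => y - x).

Definition rdifferentiable (R : realType) (n : nat) (X : set 'rV[R]_n)
    (phi : 'rV[R]_n -> R) (x : 'rV[R]_n) : Prop :=
  exists g, is_rgrad X phi x g.

(* At x in ri X there is at most one g with is_rgrad X phi x g; the value is 0
   when there is none. *)
Definition rgrad (R : realType) (n : nat) (X : set 'rV[R]_n)
    (phi : 'rV[R]_n -> R) (x : 'rV[R]_n) : 'rV[R]_n :=
  xget 0 [set g | is_rgrad X phi x g].

(* The matrix H represents the derivative of the gradient along aff X at x.
   It is determined on aff_dir X only. *)
Definition is_rhess (R : realType) (n : nat) (X : set 'rV[R]_n)
    (phi : 'rV[R]_n -> R) (x : 'rV[R]_n) (H : 'M[R]_n) : Prop :=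
  (fun y => rgrad X phi y - rgrad X phi x - (y - x) *m H)
    =o_ (within (ri X) (nbhs x)) (fun y => y - x).

(* As a matrix representing the Hessian can be normalized by precomposing with
   the projection onto aff_dir X, asking for some continuous family of
   representatives is the same as asking that the Hessian, as a map on
   aff_dir X, depend continuously on the point. *)
Definition rC2 (R : realType) (n : nat) (X : set 'rV[R]_n)
    (phi : 'rV[R]_n -> R) : Prop :=
  (forall x, ri X x -> rdifferentiable X phi x) /\
  exists H : 'rV[R]_n -> 'M[R]_n,
    (forall x, ri X x -> is_rhess X phi x (H x)) /\
    {within ri X, continuous H}.

Definition strictly_convex_on (R : realType) (n : nat) (A : set 'rV[R]_n)
    (phi : 'rV[R]_n -> R) : Prop :=
  forall (x y : 'rV[R]_n) (t : R), A x -> A y -> x != y -> 0 < t -> t < 1 ->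
    phi (t *: x + (1 - t) *: y) < t * phi x + (1 - t) * phi y.

Definition legendre_C2 (R : realType) (n : nat) (X : set 'rV[R]_n)
    (h : 'rV[R]_n -> R) : Prop :=
  [/\ rC2 X h,
      strictly_convex_on (ri X) h
    & forall (u : nat -> 'rV[R]_n) (z : 'rV[R]_n),
        (forall j, ri X (u j)) -> X z -> ~ ri X z -> u @ \oo --> z ->
        (fun j => enorm (rgrad X h (u j))) @ \oo --> +oo].

(* The continuous extension of h from ri X to X, with value +oo at the points
   of X where h has no finite limit along ri X. *)
Definition hext (R : realType) (n : nat) (X : set 'rV[R]_n)
    (h : 'rV[R]_n -> R) (x : 'rV[R]_n) : \bar R :=
  if `[< ri X x >] then (h x)%:E
  else if `[< cvg (h @ within (ri X) (nbhs x)) >]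
  then (lim (h @ within (ri X) (nbhs x)))%:E
  else +oo%E.

(* Meaningful for x in X and y in ri X. *)
Definition bregman (R : realType) (n : nat) (X : set 'rV[R]_n)
    (h : 'rV[R]_n -> R) (x y : 'rV[R]_n) : \bar R :=
  (hext X h x - (h y)%:E - (dot (rgrad X h y) (x - y))%:E)%E.

Definition argmin (R : realType) (T : Type) (A : set T) (F : T -> \bar R) :
    set T :=
  [set x | A x /\ forall y, A y -> (F x <= F y)%E].

(* Main.v *)
Require Import Defs.
From mathcomp Require Import ring lra.

(** Everything follows from one inequality per proximal step. Write y for the
    new iterate and z for the old one. Comparing y in the proximal problem with
    the points y + t (x - y) of a segment towards some x in X, and bounding f on
    that segment by convexity, gives after division by t and passage to the
    limit t -> 0+
      eta (f y - f x) <= <grad h y - grad h z, x - y>.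
    The right-hand side is D(x, z) - D(x, y) - D(y, z) by an algebraic identity,
    which holds whatever finite value is given to h at x; this is [prox_step].
    The limit is taken along a segment issued from a relatively interior point:
    such a segment remains in ri X, except possibly for its far end
    ([ri_segment]), and [rgrad_segment] turns the little-o defining grad h into
    a one-sided derivative along it.

    For x = xstar, the inequality says that D(xstar, x_k) decreases by at least
    the nonnegative number eta_k (f x_(k+1) - fstar), because D(y, z) >= 0.
    Summing telescopes, and the remaining term D(xstar, x_(K+1)) is dropped
    thanks to [bregR_ge0], which covers an xstar outside ri X by letting a
    point of ri X move to xstar along a segment. Comparing y with z in the
    proximal problem shows that f x_k is nonincreasing, so that the weighted
    sum bounds S_K (f x_(K+1) - fstar). *)

Set Implicit Arguments.
Unset Strict Implicit.
Unset Printing Implicit Defensive.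

Local Open Scope classical_set_scope.
Local Open Scope ring_scope.

(** * The inner product *)

Lemma dotZr (R : realType) (n : nat) (t : R) (u v : 'rV[R]_n) :
  dot u (t *: v) = t * dot u v.
Proof.
by rewrite /dot mulr_sumr; apply: eq_bigr => i _; rewrite !mxE mulrCA.
Qed.

Lemma dotDr (R : realType) (n : nat) (u v w : 'rV[R]_n) :
  dot u (v + w) = dot u v + dot u w.
Proof.
by rewrite /dot -big_split; apply: eq_bigr => i _; rewrite !mxE mulrDr.
Qed.

Lemma dotBr (R : realType) (n : nat) (u v w : 'rV[R]_n) :
  dot u (v - w) = dot u v - dot u w.
Proof. by rewrite dotDr -scaleN1r dotZr mulN1r. Qed.

(** * Segments issued from the relative interior *)

Lemma aff_lineX (R : realType) (n : nat) (X : set 'rV[R]_n) (a : R)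
    (w y : 'rV[R]_n) :
  aff X w -> X y -> aff X (a *: w + (1 - a) *: y).
Proof.
move=> [m [c [z [zX c1 ->]]]] yX.
exists m.+1, (fun i => if unlift ord0 i is Some j then a * c j else 1 - a),
  (fun i => if unlift ord0 i is Some j then z j else y); split.
- by move=> i; case: unliftP => [j|] _.
- rewrite big_ord_recl unlift_none.
  under eq_bigr do rewrite liftK.
  by rewrite -mulr_sumr c1 mulr1 subrK.
- rewrite big_ord_recl unlift_none addrC; congr (_ + _).
  by rewrite scaler_sumr; apply: eq_bigr => i _; rewrite liftK scalerA.
Qed.

Lemma convex_segment (R : realType) (n : nat) (X : set 'rV[R]_n) (t : R)
    (x y : 'rV[R]_n) :
  convex_set X -> X x -> X y -> 0 <= t <= 1 -> X (x + t *: (y - x)).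
Proof.
move=> cX xX yX t01.
have := cX y x (Itv01 (andP t01).1 (andP t01).2) (mem_set yX) (mem_set xX).
rewrite inE /conv /= /unstable.onem; congr (X _).
by rewrite scalerBl scalerBr scale1r addrCA addrA.
Qed.

Lemma convex_fun_segment (R : realType) (n : nat) (X : set 'rV[R]_n)
    (f : 'rV[R]_n -> R) (t : R) (x y : 'rV[R]_n) :
  convex_function X f -> X x -> X y -> 0 <= t <= 1 ->
  f (x + t *: (y - x)) <= f x + t * (f y - f x).
Proof.
move=> cf xX yX t01.
have := cf (Itv01 (andP t01).1 (andP t01).2) y x (mem_set yX) (mem_set xX).
rewrite convRE /conv /= /unstable.onem => H.
have -> : x + t *: (y - x) = t *: y + (1 - t) *: x.
  by rewrite scalerBl scalerBr scale1r addrCA addrA.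
by apply: le_trans H _; lra.
Qed.

Lemma cvg_segment (R : realType) (n : nat) (x d : 'rV[R]_n) :
  x + t *: d @[t --> 0^'+] --> x.
Proof.
rewrite -[X in _ --> X]addr0 -(scale0r d).
apply: cvgD; first exact: cvg_cst.
apply: cvgZr_tmp.
exact/cvg_at_right_filter/cvg_id.
Qed.

Lemma near_segment (R : realType) (n : nat) (x d : 'rV[R]_n)
    (P : 'rV[R]_n -> Prop) :
  (\forall w \near x, P w) -> \forall t \near 0^'+, P (x + t *: d).
Proof. by move=> xP; have := @cvg_segment R n x d P xP. Qed.

(** Let z be the point of parameter t < 1. A point w of aff X close to z lies
    on the segment from u w to y at the same parameter t, where u is the
    homothety of centre y and ratio (1 - t)^-1. As u maps z to x and is
    continuous, u w is a point of aff X close to x, hence a point of X, and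
    convexity puts w in X. *)
Lemma ri_segment (R : realType) (n : nat) (X : set 'rV[R]_n) (t : R)
    (x y : 'rV[R]_n) :
  convex_set X -> ri X x -> X y -> 0 <= t -> t < 1 ->
  ri X (x + t *: (y - x)).
Proof.
move=> cX [xX riX] yX t0 t1; split.
  by apply: convex_segment => //; rewrite t0 ltW.
set z := x + t *: (y - x).
have s0 : 1 - t != 0 by rewrite subr_eq0 gt_eqF.
pose u (w : 'rV[R]_n) := x + (1 - t)^-1 *: (w - z).
have uE w : u w = (1 - t)^-1 *: w + (1 - (1 - t)^-1) *: y.
  by apply/rowP => i; rewrite /u /z !mxE; field.
have wE w : w = u w + t *: (y - u w).
  by apply/rowP => i; rewrite uE !mxE; field.
have cu : u w @[w --> z] --> x.
  rewrite /u -[X in _ --> X]addr0 -(scaler0 _ (1 - t)^-1) -(subrr z).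
  apply: (@cvgD _ _ _ (nbhs z)); first exact: cvg_cst.
  apply: (@cvgZl_tmp _ _ _ (nbhs z)).
  by apply: (@cvgB _ _ _ (nbhs z)); [exact: cvg_id|exact: cvg_cst].
apply: (@filterS _ (nbhs z) _ _ _ _ (cu _ riX)) => w /= H wX.
rewrite (wE w); apply: convex_segment => //; last by rewrite t0 ltW.
by apply: H; rewrite uE; exact: aff_lineX.
Qed.

Lemma ri_segment_near (R : realType) (n : nat) (X : set 'rV[R]_n)
    (x y : 'rV[R]_n) :
  convex_set X -> ri X x -> X y ->
  \forall t \near 0^'+, ri X (x + t *: (y - x)).
Proof.
move=> cX xX yX; near=> t; apply: ri_segment => //.
Unshelve. all: by end_near. Qed.

(** The gradient along aff X gives the right derivative of t |-> phi at the
    points of a segment: for small t these points belong to ri X, where the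
    little-o applies, and their distance to x is proportional to t. *)
Lemma rgrad_segment (R : realType) (n : nat) (X : set 'rV[R]_n)
    (phi : 'rV[R]_n -> R) (g x y : 'rV[R]_n) :
  convex_set X -> ri X x -> X y -> is_rgrad X phi x g ->
  t^-1 * (phi (x + t *: (y - x)) - phi x) @[t --> 0^'+] --> dot g (y - x).
Proof.
move=> cX xX yX [_ /eq_some_oP og].
apply/cvgrPdist_le => e e0.
(* The relative error e / |y - x| would do; the 1 covers y = x. *)
pose d := e / (1 + `|y - x|).
have D0 : 0 < 1 + `|y - x| by rewrite ltr_pwDl.
have d0 : 0 < d by rewrite divr_gt0.
set z := fun t : R => x + t *: (y - x).
have H : \forall t \near 0^'+, ri X (z t) ->
    `|phi (z t) - phi x - dot g (z t - x)| <= d * `|z t - x|.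
  have {}og : \forall w \near x, ri X w ->
      `|phi w - phi x - dot g (w - x)| <= d * `|w - x| by exact: og d d0.
  by have := near_segment (y - x) og.
near=> t.
have t0 : 0 < t by [].
have rt : ri X (z t).
  by near: t; exact: ri_segment_near.
have Ht : ri X (z t) ->
    `|phi (z t) - phi x - dot g (z t - x)| <= d * `|z t - x| by near: t.
have zx : z t - x = t *: (y - x) by rewrite /z addrAC subrr add0r.
move: (Ht rt); rewrite zx dotZr normrZ (gtr0_norm t0) => {}Ht.
rewrite distrC -[dot g _](mulKf (lt0r_neq0 t0)) -mulrBr normrM normfV.
rewrite (gtr0_norm t0) ler_pdivrMl//.
apply: le_trans Ht _.
rewrite mulrCA ler_pM2l// /d -mulrA ger_pMr// mulrC ler_pdivrMr// mul1r.
by rewrite lerDr.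
Unshelve. all: by end_near. Qed.

(** * Bregman distances and the three-point identity *)

Lemma rgradP (R : realType) (n : nat) (X : set 'rV[R]_n)
    (phi : 'rV[R]_n -> R) (x : 'rV[R]_n) :
  rdifferentiable X phi x -> is_rgrad X phi x (rgrad X phi x).
Proof. by move=> [g xg]; rewrite /rgrad; case: xgetP => [g' -> //|/(_ g)]. Qed.

Lemma rgrad_le (R : realType) (n : nat) (X : set 'rV[R]_n)
    (phi : 'rV[R]_n -> R) (g x y : 'rV[R]_n) (c : R) :
  convex_set X -> ri X x -> X y -> is_rgrad X phi x g ->
  (forall t, 0 < t -> t < 1 -> phi (x + t *: (y - x)) <= phi x + t * c) ->
  dot g (y - x) <= c.
Proof.
move=> cX xX yX xg H; apply: cvgr_to_le (rgrad_segment cX xX yX xg) _.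
near=> t; rewrite ler_pdivrMl// lerBlDl; apply: H => //.
Unshelve. all: by end_near. Qed.

Lemma rgrad_ge (R : realType) (n : nat) (X : set 'rV[R]_n)
    (phi : 'rV[R]_n -> R) (g x y : 'rV[R]_n) (c : R) :
  convex_set X -> ri X x -> X y -> is_rgrad X phi x g ->
  (forall t, 0 < t -> t < 1 -> phi x + t * c <= phi (x + t *: (y - x))) ->
  c <= dot g (y - x).
Proof.
move=> cX xX yX xg H; apply: cvgr_to_ge (rgrad_segment cX xX yX xg) _.
near=> t; rewrite ler_pdivlMl// lerBrDl; apply: H => //.
Unshelve. all: by end_near. Qed.

(** The real-valued Bregman distance, with c standing for h x: at a point x
    outside ri X the relevant value is the limit of h, not [h x]. *)
Definition bregR (R : realType) (n : nat) (X : set 'rV[R]_n)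
    (h : 'rV[R]_n -> R) (c : R) (x y : 'rV[R]_n) : R :=
  c - h y - dot (rgrad X h y) (x - y).

Lemma bregman_fin (R : realType) (n : nat) (X : set 'rV[R]_n)
    (h : 'rV[R]_n -> R) (c : R) (x y : 'rV[R]_n) :
  hext X h x = c%:E -> bregman X h x y = (bregR X h c x y)%:E.
Proof. by rewrite /bregman => ->. Qed.

Lemma hext_ri (R : realType) (n : nat) (X : set 'rV[R]_n)
    (h : 'rV[R]_n -> R) (x : 'rV[R]_n) :
  ri X x -> hext X h x = (h x)%:E.
Proof. by move=> xX; rewrite /hext asboolT. Qed.

Lemma hext_fin_num (R : realType) (n : nat) (X : set 'rV[R]_n)
    (h : 'rV[R]_n -> R) (x y : 'rV[R]_n) :
  (bregman X h x y < +oo)%E -> exists c, hext X h x = c%:E.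
Proof.
rewrite /bregman /hext; case: ifP => _; first by eexists.
by case: ifP => // _; eexists.
Qed.

(** Convexity bounds the difference quotients of h from y towards x by
    h x - h y, hence also their limit. *)
Lemma bregR_ri_ge0 (R : realType) (n : nat) (X : set 'rV[R]_n)
    (h : 'rV[R]_n -> R) (x y : 'rV[R]_n) :
  convex_set X -> strictly_convex_on (ri X) h -> rdifferentiable X h y ->
  ri X x -> ri X y -> 0 <= bregR X h (h x) x y.
Proof.
move=> cX sh dh xX yX; rewrite /bregR subr_ge0.
apply: (rgrad_le cX yX xX.1 (rgradP dh)) => t t0 t1.
have [->|xy] := eqVneq x y; first by rewrite !subrr scaler0 mulr0 !addr0.
have := sh x y t xX yX xy t0 t1.
have -> : t *: x + (1 - t) *: y = y + t *: (x - y).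
  by rewrite scalerBl scalerBr scale1r addrCA addrA.
by move/ltW/le_trans; apply; lra.
Qed.

(** At a point x outside ri X, the distance is the limit for t -> 0+ of the
    distances from y to x + t (y - x), a point of ri X where h is close to its
    limit value c. *)
Lemma bregR_ge0 (R : realType) (n : nat) (X : set 'rV[R]_n)
    (h : 'rV[R]_n -> R) (c : R) (x y : 'rV[R]_n) :
  convex_set X -> strictly_convex_on (ri X) h -> rdifferentiable X h y ->
  hext X h x = c%:E -> X x -> ri X y -> 0 <= bregR X h c x y.
Proof.
move=> cX sh dh; rewrite /hext; case: asboolP => [xX [<-] _ yX|xX].
  exact: bregR_ri_ge0.
case: asboolP => // ch [<-] {}xX yX.
set l := lim _.
have z1 t : x + t *: (y - x) = y + (1 - t) *: (x - y).
  by apply/rowP => i; rewrite !mxE; ring.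
have zX : \forall t \near 0^'+, ri X (x + t *: (y - x)).
  near=> t; rewrite z1; apply: ri_segment => //.
    by rewrite subr_ge0; near: t; exact: nbhs_right_le.
  by rewrite gtrBl.
have hl : h (x + t *: (y - x)) @[t --> 0^'+] --> l.
  apply: cvg_trans ch => A /= hA.
  have {}hA : \forall t \near 0^'+,
      ri X (x + t *: (y - x)) -> A (h (x + t *: (y - x))).
    by have := near_segment (y - x) hA.
  by apply: filterS2 hA zX => t; apply.
have Dl : bregR X h (h (x + t *: (y - x))) (x + t *: (y - x)) y
    @[t --> 0^'+] --> bregR X h l x y.
  rewrite /bregR; apply: cvgB.
    by apply: cvgB => //; exact: cvg_cst.
  have -> : (fun t => dot (rgrad X h y) (x + t *: (y - x) - y)) =
      (fun t => (1 - t) * dot (rgrad X h y) (x - y)).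
    by apply/funext => t; rewrite z1 addrAC subrr add0r dotZr.
  set a := dot _ (x - y).
  have La : (1 - t) * a @[t --> 0^'+] --> (1 - 0) * a.
    apply: cvgM; last exact: cvg_cst.
    apply: cvgB; first exact: cvg_cst.
    exact/cvg_at_right_filter/cvg_id.
  by rewrite subr0 mul1r in La.
apply: cvgr_to_ge Dl _; near=> t; apply: bregR_ri_ge0 => //.
by near: t.
Unshelve. all: by end_near. Qed.

Lemma bregR_three_point (R : realType) (n : nat) (X : set 'rV[R]_n)
    (h : 'rV[R]_n -> R) (c : R) (x y z : 'rV[R]_n) :
  dot (rgrad X h y) (x - y) - dot (rgrad X h z) (x - y) =
  bregR X h c x z - bregR X h c x y - bregR X h (h y) y z.
Proof.
have -> : dot (rgrad X h z) (x - y) =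
    dot (rgrad X h z) (x - z) - dot (rgrad X h z) (y - z).
  by rewrite -dotBr opprB addrA subrK.
by rewrite /bregR; ring.
Qed.

(** * The proximal step and the convergence rate *)

(** First-order optimality of y tested along the segment from y to x. At x
    itself the proximal objective may be infinite or involve the extension of
    h, but for t < 1 the points of the segment are in ri X, where it is finite
    and explicit. *)
Lemma prox_step (R : realType) (n : nat) (X : set 'rV[R]_n)
    (h f : 'rV[R]_n -> R) (c e : R) (x y z : 'rV[R]_n) :
  convex_set X -> convex_function X f -> rdifferentiable X h y -> 0 < e ->
  ri X y ->
  argmin X (fun w => (f w)%:E + e^-1%:E * bregman X h w z)%E y ->
  X x ->
  e * (f y - f x) <=
    bregR X h c x z - bregR X h c x y - bregR X h (h y) y z.
Proof.
move=> cX cf dh e0 yX [_ ymin] xX.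
rewrite -bregR_three_point lerBrDr.
apply: (rgrad_ge cX yX xX (rgradP dh)) => t t0 t1.
have wX : ri X (y + t *: (x - y)) by apply: ri_segment => //; exact: ltW.
have := ymin _ wX.1.
rewrite !(bregman_fin _ (hext_ri _ _))// -!EFinM -!EFinD lee_fin => hle.
have t01 : 0 <= t <= 1 by rewrite !ltW.
have fle := convex_fun_segment cf yX.1 xX t01.
move: hle; set Dy := bregR X h _ y z; set Dw := bregR X h _ _ z => hle.
have {hle fle} : t * (f y - f x) <= e^-1 * (Dw - Dy) by lra.
rewrite ler_pdivlMl// /Dw /Dy /bregR.
have -> : y + t *: (x - y) - z = (y - z) + t *: (x - y) by rewrite addrAC.
rewrite dotDr dotZr; lra.
Qed.

Theorem theorem7p2 (R : realType) (n : nat) (X : set 'rV[R]_n)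
    (h f : 'rV[R]_n -> R) (x : nat -> 'rV[R]_n) (eta : nat -> R)
    (xstar : 'rV[R]_n) (S := fun K : nat => \sum_(k < K.+1) eta k) :
  X !=set0 -> closed X -> convex_set X ->
  legendre_C2 X h ->
  convex_function X f ->
  (forall y, ri X y -> rdifferentiable X f y) ->
  (forall k, 0 < eta k) ->
  (forall k, ri X (x k)) ->
  (forall k, argmin X
     (fun y => (f y)%:E + ((eta k)^-1)%:E * bregman X h y (x k))%E (x k.+1)) ->
  argmin X (fun y => (f y)%:E) xstar ->
  (bregman X h xstar (x 0%N) < +oo)%E ->
  [/\ forall K : nat,
        ((\sum_(k < K.+1) eta k * (f (x k.+1) - f xstar))%:E
           <= bregman X h xstar (x 0%N))%E,
      forall k : nat, f (x k.+1) <= f (x k),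
      forall K : nat,
        ((f (x K.+1) - f xstar)%:E
           <= bregman X h xstar (x 0%N) / (S K)%:E)%E,
      forall k : nat,
        (bregman X h xstar (x k.+1) <= bregman X h xstar (x k))%E
    & S @ \oo --> +oo ->
      f (x k) @[k --> \oo] --> f xstar /\
      forall p : 'rV[R]_n, cluster (x @ \oo) p ->
        f @ within X (nbhs p) --> f p ->
        argmin X (fun y => (f y)%:E) p].
Proof.
move=> _ clX cX [[dh _] sh _] cf _ eta0 xX step [xsX xsmin] /hext_fin_num[c hc].
pose D k := bregR X h c xstar (x k).
have DE k : bregman X h xstar (x k) = (D k)%:E by exact: bregman_fin.
have D0 k : 0 <= D k by apply: bregR_ge0 => //; exact: dh.
have fge y : X y -> f xstar <= f y by move=> yX; rewrite -lee_fin xsmin.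
have d0 k : 0 <= bregR X h (h (x k.+1)) (x k.+1) (x k).
  by apply: bregR_ri_ge0 => //; exact: dh.
have descent k : eta k * (f (x k.+1) - f xstar) <= D k - D k.+1.
  have := prox_step c cX cf (dh _ (xX _)) (eta0 k) (xX _) (step k) xsX.
  by move/le_trans; apply; rewrite gerBl.
have gap0 k : 0 <= eta k * (f (x k.+1) - f xstar).
  by rewrite mulr_ge0 ?(ltW (eta0 k))// subr_ge0; apply: fge; exact: (xX _).1.
have sumD K : \sum_(k < K.+1) eta k * (f (x k.+1) - f xstar) <= D 0%N.
  apply: (@le_trans _ _ (\sum_(k < K.+1) (D k - D k.+1))).
    by apply: ler_sum => k _; exact: descent.
  rewrite -(big_mkord xpredT (fun k => D k - D k.+1)).
  by under eq_bigr do rewrite -opprB; rewrite sumrN telescope_sumr// opprB gerBl.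
have fmono k : f (x k.+1) <= f (x k).
  have := (step k).2 _ (xX k).1.
  rewrite !(bregman_fin _ (hext_ri _ _))// -!EFinM -!EFinD lee_fin.
  (* The comparison point x_k has distance 0 to itself. *)
  rewrite {2}/bregR !subrr sub0r /dot big1 ?oppr0 ?mulr0 ?addr0.
    by apply: le_trans; rewrite lerDl mulr_ge0// invr_ge0 ltW.
  by move=> i _; rewrite mxE mulr0.
have S0 K : 0 < S K.
  by rewrite /S big_ord_recl ltr_pwDl// sumr_ge0// => i _; exact: ltW.
have fni k l : (k <= l)%N -> f (x l) <= f (x k).
  apply: (@homo_leq _ (fun k => f (x k)) (fun a b => b <= a)) => // a b e.
  by move=> /[swap]; exact: le_trans.
have rate K : f (x K.+1) - f xstar <= D 0%N / S K.
  rewrite ler_pdivlMr// mulrC; apply: le_trans (sumD K).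
  rewrite /S mulr_suml; apply: ler_sum => k _.
  by rewrite ler_pM2l// lerD2r fni// ltnS.
split.
- by move=> K; rewrite DE lee_fin.
- exact: fmono.
- by move=> K; rewrite DE inver gt_eqF// -EFinM lee_fin.
- move=> k; rewrite !DE lee_fin -subr_ge0.
  exact: le_trans (gap0 k) (descent k).
move=> Soo.
(* The rate concerns f at x_(K+1), hence the shift by one. *)
have flim : f (x k) @[k --> \oo] --> f xstar.
  rewrite -cvg_shiftS /=; apply/subr_cvg0.
  apply: (@squeeze_cvgr _ _ _ _ (fun=> 0) (fun k => D 0%N / S k)).
  - by near=> k; rewrite rate subr_ge0 andbT; apply: fge; exact: (xX _).1.
  - exact: cvg_cst.
  - rewrite -[X in _ --> X](mulr0 (D 0%N)); apply: cvgM; first exact: cvg_cst.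
    by apply/gtr0_cvgV0 => //; near=> k.
split=> // p xp fp.
have pX : X p.
  apply: clX => B pB.
  have xXoo : \forall k \near \oo, X (x k) by near=> k; have [] := xX k.
  by have [w wXB] := xp _ _ xXoo pB; exists w.
split=> // y yX; rewrite lee_fin; apply: le_trans (fge _ yX).
apply/ler_addgt0Pr => e e0.
(* Some iterate is both late enough for f to be close to fstar and near enough
   to p for f to be close to f p. *)
have fx_near : \forall k \near \oo, X (x k) /\ f (x k) < f xstar + e / 2.
  near=> k; split; first by have [] := xX k.
  near: k; apply: (cvgr_lt _ flim); rewrite ltrDl divr_gt0//.
have fp_near : nbhs p [set w | X w -> f p - e / 2 < f w].
  by apply: (cvgr_gt _ fp); rewrite gtrBl divr_gt0//.
have [w /= [[wX fw]]] :=
  xp [set w | X w /\ f w < f xstar + e / 2] _ fx_near fp_near.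
by move=> /(_ wX); lra.
Unshelve. all: by end_near. Qed.
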